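(* Let $\mathcal X$ be the fundamental pattern of a matroid $M$. Then a matroid $M'$ is an adjoint of $M$ if and only if (with the ground set of $M'$ identified with the set of row labels of $\mathcal X$, i.e., with the set of hyperplanes of $M$) $M'\in\mathcal R(\mathcal X^T)$ and $r(M')=r(M)$.
   Context: The fundamental pattern of a matroid $M$ is the $\{0,*\}$-matrix with one row for each hyperplane of $M$ and one column for each element of $E(M)$, whose entry in row $H$, column $e$ is $0$ if and only if $e\in H$. For a zero-nonzero pattern $\mathcal Y$, the zero set of a row is the set of column labels where that row has entry $0$, and $\mathcal R(\mathcal Y)$ is the set of all matroids on the set of column labels of $\mathcal Y$ such that the zero set of every row of $\mathcal Y$ is a flat. A simple matroid $M'$ is an adjoint of a matroid $M$ if $r(M')=r(M)$ and there is a map $\phi:L(M)\to L(M')$ between lattices of flats such that (i) $\phi$ is injective; (ii) if $F_1\subseteq F_2$ are flats of $M$ then $\phi(F_2)\subseteq\phi(F_1)$; (iii) $\phi$ restricts to a bijection from the hyperplanes of $M$ onto the points (rank-$1$ flats) of $M'$. *)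

(* Defs.v *)
From mathcomp Require Import all_boot.

Set Implicit Arguments.
Unset Strict Implicit.
Unset Printing Implicit Defensive.

(* A matroid whose ground set is the whole finite type E (possibly empty). *)
Record matroid (E : finType) := Matroid {
  indep : {set {set E}};
  indep0 : set0 \in indep;
  indepS : forall I J : {set E}, J \subset I -> I \in indep -> J \in indep;
  indep_aug : forall I J : {set E}, I \in indep -> J \in indep -> #|I| < #|J| ->
    exists2 e, e \in J :\: I & e |: I \in indep
}.

Section MatroidNotions.
Variables (E : finType) (M : matroid E).
Implicit Types (A C F H P : {set E}) (e : E).

Definition rank A : nat := \max_(I in indep M | I \subset A) #|I|.

Definition mrank : nat := rank [set: E].

Definition cl A : {set E} := [set e | rank (e |: A) == rank A].

Definition flat F : bool := cl F == F.

(* The rank condition is written without subtraction, so a matroid of rank 0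
   has no hyperplanes. *)
Definition hyperplane H : bool := flat H && ((rank H).+1 == mrank).

Definition point P : bool := flat P && (rank P == 1).

Definition circuit C : bool := minset [pred A | A \notin indep M] C.

(* No loops and no parallel pairs. *)
Definition simple : Prop := forall C, circuit C -> 2 < #|C|.

Definition flats : finType := {F : {set E} | flat F}.

Definition hyperplanes : finType := {H : {set E} | hyperplane H}.

End MatroidNotions.

Definition matroid_iso (E E' : finType) (N : matroid E) (M' : matroid E') : Prop :=
  exists2 f : E -> E', bijective f &
    forall I : {set E}, (I \in indep N) = (f @: I \in indep M').

Inductive entry := Zero | Star.

Definition pattern (R C : finType) := R -> C -> entry.

Definition zero_set (R C : finType) (Y : pattern R C) (r : R) : {set C} :=
  [set c | if Y r c is Zero then true else false].

Arguments zero_set {R C} Y r.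

Definition tr_pattern (R C : finType) (Y : pattern R C) : pattern C R :=
  fun c r => Y r c.

Arguments tr_pattern {R C} Y c r.

Definition in_R (R C : finType) (Y : pattern R C) (N : matroid C) : Prop :=
  forall r : R, flat N (zero_set Y r).

Arguments in_R {R C} Y N.

Definition fundamental_pattern (E : finType) (M : matroid E) :
    pattern (hyperplanes M) E :=
  fun H e => if e \in val H then Zero else Star.

Arguments fundamental_pattern {E} M H e.

Section Adjoint.
Variables (E E' : finType) (M : matroid E) (M' : matroid E').

Definition adjoint_map (phi : flats M -> flats M') : Prop :=
  [/\ injective phi,
      forall F1 F2 : flats M, val F1 \subset val F2 ->
        val (phi F2) \subset val (phi F1)
    & [/\ forall F : flats M, hyperplane M (val F) -> point M' (val (phi F)),
          forall F1 F2 : flats M, hyperplane M (val F1) ->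
            hyperplane M (val F2) -> phi F1 = phi F2 -> F1 = F2
        & forall P : flats M', point M' (val P) ->
            exists2 F : flats M, hyperplane M (val F) & phi F = P]].

Definition adjoint : Prop :=
  [/\ simple M', mrank M' = mrank M
    & exists phi : flats M -> flats M', adjoint_map phi].

End Adjoint.

(* For N on the set of hyperplanes of M: N is an adjoint of M by a map phi that
   induces the tautological labelling, i.e. sends each hyperplane H to the point
   {H}. For an arbitrary phi the induced labelling of the ground set of N would
   only be some permutation of the hyperplanes. *)
Definition labelled_adjoint (E : finType) (M : matroid E)
    (N : matroid (hyperplanes M)) : Prop :=
  [/\ simple N, mrank N = mrank M
    & exists2 phi : flats M -> flats N, adjoint_map phi &
        forall (F : flats M) (H : hyperplanes M),
          val F = val H -> val (phi F) = [set H]].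

(* Main.v *)
Require Import Defs.
From mathcomp Require Import all_boot.

Set Implicit Arguments.
Unset Strict Implicit.
Unset Printing Implicit Defensive.

(** A map between lattices of flats of matroids of equal rank [r] that reverses
    inclusions strictly must send rank [k] to rank [r - k], since it turns
    maximal chains into chains of the same length.

    If the sets [Z e] of hyperplanes through [e] are flats, then
    [F |-> {H | F \subset H}], an intersection of such sets, is a strictly
    order-reversing map into flats; the rank formula makes every [{H}] a point.

    Conversely let [phi] be an adjoint map with [phi H = {H}].  Then [Z e] is
    the flat [phi (cl {e})]: if [phi G \subset phi (cl {e})] but [e \notin G],
    pick a flat [G'] covered by [G]; [phi G'] is the join of [phi G] and
    [phi (cl (e |: G'))], so it lies below [phi (cl {e})] as well.  Descending
    to [G = cl set0] contradicts the rank formula. *)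

(** * Rank, closure, flats and hyperplanes of a matroid *)

Section MatroidRank.
Variables (E : finType) (M : matroid E).
Implicit Types (A B F G I J : {set E}) (e x : E).

Lemma card_indep_le_rank A I : I \in indep M -> I \subset A -> #|I| <= rank M A.
Proof.
by move=> iI sIA; apply: (bigmax_sup I); rewrite // iI.
Qed.

Lemma basis_exists A :
  exists I : {set E}, [/\ I \in indep M, I \subset A & #|I| = rank M A].
Proof.
pose S := [pred J : {set E} | (J \in indep M) && (J \subset A)].
have [|I /andP[iI sIA] rE] := @eq_bigmax_cond _ S (fun J : {set E} => #|J|).
  by apply/card_gt0P; exists set0; rewrite inE /= indep0 sub0set.
by exists I; split; rewrite // -rE.
Qed.

Lemma rank_leP A n :
  (forall I, I \in indep M -> I \subset A -> #|I| <= n) -> rank M A <= n.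
Proof. by have [I [iI sI <-]] := basis_exists A; apply. Qed.

Lemma rank_mono A B : A \subset B -> rank M A <= rank M B.
Proof.
move=> sAB; apply: rank_leP => I iI sIA.
by rewrite card_indep_le_rank // (subset_trans sIA).
Qed.

Lemma rank_le_mrank A : rank M A <= mrank M.
Proof. by rewrite rank_mono ?subsetT. Qed.

Lemma rank_le_card A : rank M A <= #|A|.
Proof. by apply: rank_leP => I _ /subset_leq_card. Qed.

Lemma rank_indep I : I \in indep M -> rank M I = #|I|.
Proof.
by move=> iI; apply/eqP; rewrite eqn_leq rank_le_card card_indep_le_rank.
Qed.

Lemma indep_of_rank A : rank M A = #|A| -> A \in indep M.
Proof.
have [I [iI sIA <-]] := basis_exists A => cI.
suff <- : I = A by [].
by apply/eqP; rewrite eqEcard sIA cI /=.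
Qed.

Lemma rank0 : rank M set0 = 0.
Proof. by rewrite rank_indep ?indep0 ?cards0. Qed.

Lemma rank_setU1_le e A : rank M (e |: A) <= (rank M A).+1.
Proof.
apply: rank_leP => I iI sI; rewrite (cardsD1 e).
have le : #|I :\ e| <= rank M A.
  by apply: card_indep_le_rank; rewrite ?subDset // (indepS _ iI) ?subsetDl.
by rewrite -add1n leq_add // leq_b1.
Qed.

Lemma basis_extends I A : I \in indep M -> I \subset A ->
  exists K : {set E}, [/\ K \in indep M, I \subset K, K \subset A
                        & #|K| = rank M A].
Proof.
move=> iI sIA.
have [|K /maxsetP[/andP[iK sKA] maxK] sIK] :=
  @maxset_exists _ (fun J : {set E} => (J \in indep M) && (J \subset A)) I.
  by rewrite iI.
exists K; split=> //; apply/eqP; rewrite eqn_leq card_indep_le_rank //=.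
have [J [iJ sJA <-]] := basis_exists A.
rewrite leqNgt; apply/negP => /(indep_aug iK iJ)[e /setDP[eJ /negP eK] ieK].
apply: eK; rewrite -(maxK (e |: K)) ?setU11 ?subsetU1 // ieK subUset sKA sub1set.
by rewrite (subsetP sJA).
Qed.

Lemma mem_cl e A : (e \in cl M A) = (rank M (e |: A) == rank M A).
Proof. by rewrite inE. Qed.

Lemma rank_setU1 e A : e \notin cl M A -> rank M (e |: A) = (rank M A).+1.
Proof.
rewrite mem_cl => neq; apply/eqP; rewrite eqn_leq rank_setU1_le /=.
by rewrite ltn_neqAle eq_sym neq rank_mono ?subsetU1.
Qed.

Lemma sub_cl A : A \subset cl M A.
Proof. by apply/subsetP => e eA; rewrite mem_cl (setUidPr _) ?sub1set. Qed.

(** A larger independent subset of the closure would augment a basis of [A] by some [e] in [cl M A],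
    although adding such an [e] to [A] leaves the rank unchanged. *)
Lemma rank_cl A : rank M (cl M A) = rank M A.
Proof.
apply/eqP; rewrite eqn_leq [X in _ && X]rank_mono ?sub_cl // andbT.
have [I [iI sIA cI]] := basis_exists A; have [J [iJ sJ <-]] := basis_exists (cl M A).
rewrite -cI leqNgt; apply/negP => /(indep_aug iI iJ)[e /setDP[eJ eI] ieI].
have := subsetP sJ e eJ; rewrite mem_cl => /eqP re.
have := card_indep_le_rank ieI (setUS [set e] sIA).
by rewrite re -cI cardsU1 eI ltnn.
Qed.

(** If [e] raises the rank of [B], extend a basis [I] of [A] to a basis [K] of [B]. Augmenting [K]
    inside [e |: B] can only add [e], so [e |: I] is independent and [e] raises the rank of [A]
    too. *)
Lemma cl_mono A B : A \subset B -> cl M A \subset cl M B.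
Proof.
move=> sAB; apply/subsetP => e; apply: contraLR => eB.
have [I [iI sIA cI]] := basis_exists A.
have [K [iK sIK sKB cK]] := basis_extends iI (subset_trans sIA sAB).
have [J [iJ sJ cJ]] := basis_exists (e |: B).
have [|x /setDP[xJ xK] ixK] := indep_aug iK iJ.
  by rewrite cJ cK rank_setU1.
have xe : x = e.
  have := subsetP sJ x xJ; rewrite !inE => /orP[/eqP //|xB].
  have := @card_indep_le_rank B _ ixK.
  rewrite subUset sub1set xB sKB -cK cardsU1 xK ltnn.
  by move=> /(_ isT).
rewrite xe in xK ixK; rewrite mem_cl neq_ltn; apply/orP; right.
have eI : e \notin I by apply: contra xK; apply: (subsetP sIK).
rewrite -cI; have := @card_indep_le_rank (e |: A) (e |: I).
rewrite cardsU1 eI; apply; last exact: setUS.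
by apply: indepS ixK; apply: setUS.
Qed.

Lemma sub_cl_of_rank A B : A \subset B -> rank M B <= rank M A -> B \subset cl M A.
Proof.
move=> sAB rBA; apply/subsetP => e eB; rewrite mem_cl eqn_leq.
rewrite [X in _ && X]rank_mono ?subsetU1 // andbT (leq_trans _ rBA) //.
by rewrite rank_mono // subUset sub1set eB.
Qed.

Lemma flatE F : flat M F -> cl M F = F.
Proof. by move/eqP. Qed.

Lemma flat_cl A : flat M (cl M A).
Proof.
rewrite /flat eqEsubset sub_cl andbT.
apply: sub_cl_of_rank; first exact: subset_trans (sub_cl A) (sub_cl _).
by rewrite !rank_cl.
Qed.

Lemma flatP F : cl M F \subset F -> flat M F.
Proof. by move=> sF; rewrite /flat eqEsubset sF sub_cl. Qed.

Lemma cl_sub_flat A F : flat M F -> A \subset F -> cl M A \subset F.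
Proof. by move=> fF /cl_mono; rewrite (flatE fF). Qed.

Lemma rank_setU1_flat e F : flat M F -> e \notin F -> rank M (e |: F) = (rank M F).+1.
Proof. by move=> fF eF; rewrite rank_setU1 ?flatE. Qed.

Lemma flat_eq_rank F A : flat M F -> F \subset A -> rank M A <= rank M F -> A = F.
Proof.
move=> fF sFA /(sub_cl_of_rank sFA).
by rewrite flatE // => sAF; apply/eqP; rewrite eqEsubset sAF.
Qed.

Lemma flat_lt_rank F A : flat M F -> F \proper A -> rank M F < rank M A.
Proof.
move=> fF pFA; have sFA := proper_sub pFA.
rewrite ltnNge; apply: contraL pFA => /(flat_eq_rank fF sFA) ->.
by rewrite properxx.
Qed.

Lemma flat_covered_by F k : flat M F -> rank M F = k.+1 ->
  exists G, [/\ flat M G, G \subset F & rank M G = k].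
Proof.
move=> fF rF; have [I [iI sIF cI]] := basis_exists F.
have /card_gt0P[x xI] : 0 < #|I| by rewrite cI rF.
exists (cl M (I :\ x)); split; first exact: flat_cl.
  by apply: cl_sub_flat => //; rewrite (subset_trans (subsetDl _ _)).
rewrite rank_cl rank_indep; last by rewrite (indepS _ iI) ?subsetDl.
by move: cI; rewrite rF (cardsD1 x) xI => -[].
Qed.

Lemma flat_covers F : flat M F -> rank M F < mrank M ->
  exists G, [/\ flat M G, F \proper G & rank M G = (rank M F).+1].
Proof.
move=> fF lt.
have /subsetPn[e _ eF] : ~~ (setT \subset F).
  by apply: contraL lt => sF; rewrite -leqNgt rank_mono.
have sF : e |: F \subset cl M (e |: F) := sub_cl _.
exists (cl M (e |: F)); split; first exact: flat_cl.
  apply/properP; split; first exact: subset_trans (subsetU1 _ _) sF.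
  by exists e; rewrite // (subsetP sF) ?setU11.
by rewrite rank_cl rank_setU1_flat.
Qed.

(** A maximal flat [H] that contains [F] and avoids [e] works: the closure of [H] with any further
    [x] must contain [e], and by exchange [x] then lies in [cl M (e |: H)], which is therefore
    everything. *)
Lemma hyperplane_separates F e : flat M F -> e \notin F ->
  exists H, [/\ hyperplane M H, F \subset H & e \notin H].
Proof.
move=> fF eF.
have [|H /maxsetP[/andP[fH eH] maxH] sFH] :=
  @maxset_exists _ (fun G : {set E} => flat M G && (e \notin G)) F.
  by rewrite fF.
exists H; split=> //; rewrite /hyperplane fH -(rank_setU1_flat fH eH) eqn_leq.
rewrite rank_le_mrank -[X in _ <= X]rank_cl; apply: rank_mono.
apply/subsetP => x _; apply: contraT => xcl.
have xH : x \notin H.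
  by apply: contra xcl => xH; rewrite (subsetP (sub_cl _)) // inE xH orbT.
have ecl : e \in cl M (x |: H).
  apply: contraT => ecl; move: (xH).
  rewrite -(maxH (cl M (x |: H))) ?flat_cl //.
    by rewrite (subsetP (sub_cl _)) ?setU11.
  exact: subset_trans (subsetU1 _ _) (sub_cl _).
move: xcl; rewrite mem_cl.
move: ecl; rewrite mem_cl => /eqP r2.
by rewrite setUCA r2 !rank_setU1_flat ?eqxx.
Qed.

Lemma point_set1 x P : point M P -> point M [set x] -> x \in P -> P = [set x].
Proof.
move=> /andP[_ /eqP rP] /andP[fx /eqP rx] xP.
by apply: flat_eq_rank; rewrite ?sub1set ?rP ?rx.
Qed.

(** In a simple matroid a set of at most two elements contains no circuit, hence is independent.
    Conversely, singletons of rank 1 exclude loops, and singletons being flats excludes parallel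
    pairs. *)
Lemma simpleP : simple M <-> forall x, point M [set x].
Proof.
split=> [sM x | pM C].
  have dep A : #|A| <= 2 -> A \in indep M.
    move=> cA; apply: contraT => dA.
    have [C mC sCA] := @minset_exists _ [pred B | B \notin indep M] A dA.
    by have := leq_trans (sM C mC) (leq_trans (subset_leq_card sCA) cA).
  have rx : rank M [set x] = 1 by rewrite rank_indep ?cards1 // dep ?cards1.
  rewrite /point rx eqxx andbT; apply: flatP; apply/subsetP => y.
  rewrite mem_cl inE rx; apply: contraTT => neq.
  by rewrite rank_indep ?dep // cardsU1 inE neq cards1.
move=> /minsetP[/= dC _]; rewrite ltnNge; apply: contra dC => cC.
have [->|[x xC]] := set_0Vmem C; first exact: indep0.
have /andP[fx /eqP rx] := pM x.
have [xE|[y]] := set_0Vmem (C :\ x).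
  have -> : C = [set x] by rewrite -(setD1K xC) xE setU0.
  by apply: indep_of_rank; rewrite rx cards1.
rewrite 2!inE => /andP[neq yC].
have sC : y |: [set x] \subset C by rewrite subUset !sub1set yC.
have cyx : #|y |: [set x]| = 2 by rewrite cardsU1 inE neq cards1.
have <- : y |: [set x] = C by apply/eqP; rewrite eqEcard sC cyx.
by apply: indep_of_rank; rewrite rank_setU1_flat ?inE // rx cyx.
Qed.

End MatroidRank.

(** * Transport of matroids, ranks and flats along a bijection *)

Section Isomorphism.
Variables (E E' : finType).

(** Used to move an adjoint onto the set of hyperplanes. An injection preserves cardinalities, so
    augmentation carries over. *)
Lemma pullback_matroid_exists (M' : matroid E') (f : E -> E') : injective f ->
  exists N : matroid E, forall I : {set E}, (I \in indep N) = (f @: I \in indep M').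
Proof.
move=> injf; pose S := [set I : {set E} | f @: I \in indep M'].
have S0 : set0 \in S by rewrite inE imset0 indep0.
have SS (I J : {set E}) : J \subset I -> I \in S -> J \in S.
  by move=> sJI; rewrite !inE; apply: indepS; apply: imsetS.
have Saug (I J : {set E}) : I \in S -> J \in S -> #|I| < #|J| ->
    exists2 e, e \in J :\: I & e |: I \in S.
  rewrite !inE => iI iJ lt.
  have [|_ /setDP[/imsetP[e eJ ->] eI] ieI] := indep_aug iI iJ.
    by rewrite !card_imset.
  exists e; last by rewrite inE imsetU1.
  by rewrite inE eJ andbT; apply: contra eI; apply: imset_f.
by exists (Matroid S0 SS Saug) => I; rewrite inE.
Qed.

Variables (N : matroid E) (M' : matroid E') (f : E -> E').
Hypotheses (bijf : bijective f)
  (indepf : forall I : {set E}, (I \in indep N) = (f @: I \in indep M')).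

Lemma rank_iso (A : {set E}) : rank M' (f @: A) = rank N A.
Proof.
have injf := bij_inj bijf.
apply/eqP; rewrite eqn_leq; apply/andP; split; apply: rank_leP => I iI sIA.
  have IE : I = f @: (f @^-1: I).
    have [g fK gK] := bijf.
    by apply/setP => y; rewrite -[y]gK mem_imset // inE.
  rewrite IE card_imset // card_indep_le_rank ?indepf -?IE //.
  by apply/subsetP => x; rewrite inE => /(subsetP sIA); rewrite mem_imset.
by rewrite -(card_imset _ injf) card_indep_le_rank -?indepf ?imsetS.
Qed.

Lemma flat_iso (A : {set E}) : flat M' (f @: A) = flat N A.
Proof.
have injf := bij_inj bijf.
suff clf : cl M' (f @: A) = f @: cl N A.
  by rewrite /flat clf (inj_eq (imset_inj injf)).
have [g fK gK] := bijf.
apply/setP => y; rewrite -[y]gK (mem_imset _ _ injf) !mem_cl -imsetU1.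
by rewrite !rank_iso.
Qed.

End Isomorphism.

(** * Injective order-reversing maps between lattices of flats *)

Section AntitoneRank.
Variables (E E' : finType) (M : matroid E) (M' : matroid E').
Variable phi : flats M -> flats M'.
Hypotheses (eq_rank : mrank M' = mrank M) (inj_phi : injective phi)
  (anti_phi : forall F1 F2 : flats M, val F1 \subset val F2 ->
     val (phi F2) \subset val (phi F1)).

Lemma antitone_rank_lt (F G : flats M) : val F \proper val G ->
  rank M' (val (phi G)) < rank M' (val (phi F)).
Proof.
move=> pFG; apply: flat_lt_rank; first exact: valP.
rewrite properEneq anti_phi ?proper_sub // andbT.
by apply: contraTneq pFG => /val_inj/inj_phi ->; rewrite properxx.
Qed.

Lemma antitone_rankD (F : flats M) :
  rank M (val F) + rank M' (val (phi F)) = mrank M.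
Proof.
(* Upper bound: descend from [F] one rank at a time, each step raising the rank of the image. Lower
   bound, further below: ascend from [F], by induction on its corank. *)
apply/eqP; rewrite eqn_leq; apply/andP; split.
  move: {2}(rank M (val F)) (erefl (rank M (val F))) => k.
  elim: k F => [|k IHk] F rF.
    by rewrite rF add0n -eq_rank rank_le_mrank.
  have [G [fG sGF rG]] := flat_covered_by (valP F) rF.
  apply: leq_trans (IHk (Sub G fG) rG); rewrite SubK rF rG addSn -addnS leq_add2l.
  apply: antitone_rank_lt; rewrite SubK properEneq sGF andbT.
  by apply/eqP => GF; move: rF; rewrite -GF rG => /n_Sn.
move: {2}(mrank M - rank M (val F)) (leqnn (mrank M - rank M (val F))) => n.
elim: n F => [|n IHn] F leF.
  by rewrite (leq_trans _ (leq_addr _ _)) // -subn_eq0 -leqn0.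
have [le|lt] := leqP (mrank M) (rank M (val F)).
  by rewrite (leq_trans le) ?leq_addr.
have [G [fG pFG rG]] := flat_covers (valP F) lt.
apply: leq_trans (IHn (Sub G fG) _) _; rewrite SubK rG.
  by rewrite leq_subLR addSnnS -leq_subLR.
by rewrite addSn -addnS leq_add2l antitone_rank_lt // SubK.
Qed.

Lemma antitone_reflects_mem (e : E) (G Fe : flats M) : val Fe = cl M [set e] ->
  val (phi G) \subset val (phi Fe) -> e \in val G.
Proof.
move=> FeE.
move: {2}(rank M (val G)) (erefl (rank M (val G))) => k.
elim: k G => [|k IHk] G rG sub.
  apply: contraT => eG.
  have G0 : val G = cl M set0.
    apply: (flat_eq_rank (M := M)); rewrite ?rank_cl ?rank0 ?rG ?flat_cl //.
    by apply: cl_sub_flat; [exact: (valP G) | exact: sub0set].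
  (* Here [e] is not a loop, so [phi Fe] has rank one less than [phi G] and cannot contain it. *)
  have rFe : rank M (val Fe) = 1.
    by rewrite FeE rank_cl -[[set e]]setU0 rank_setU1 ?rank0 -?G0.
  have := antitone_rankD Fe; rewrite -(antitone_rankD G) rG rFe.
  by move=> rE; have := rank_mono M' sub; rewrite -[X in X <= _]add0n -rE ltnn.
apply: contraT => eG.
have [G1 [fG1 sG1 rG1]] := flat_covered_by (valP G) rG.
have eG1 : e \notin G1 by apply: contra eG; apply: (subsetP sG1).
pose G1f : flats M := Sub G1 fG1.
pose K : flats M := Sub (cl M (e |: G1)) (flat_cl _ _).
have rK : rank M (val K) = k.+1 by rewrite SubK rank_cl rank_setU1_flat ?rG1.
have eK : e \in val K by rewrite SubK (subsetP (sub_cl _ _)) ?setU11.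
have sFeK : val Fe \subset val K.
  by rewrite FeE cl_sub_flat ?sub1set //; apply: valP.
have sG1K : G1 \subset val K by apply: subset_trans (sub_cl _ _); apply: subsetU1.
have rpK : rank M' (val (phi K)) = rank M' (val (phi G)).
  by apply: (@addnI k.+1); rewrite -{1}rK -rG !antitone_rankD.
have rpG1 : rank M' (val (phi G1f)) = (rank M' (val (phi G))).+1.
  apply: (@addnI k); rewrite addnS -addSn -rG antitone_rankD.
  by rewrite -(antitone_rankD G1f) SubK rG1.
(* Both images have the same rank, so inclusion would force [K = G], which contains [e]. Since
   [phi G1f] has rank only one more than [phi G], it is spanned by [phi G] and [b]. *)
have /subsetPn[b bK bG] : ~~ (val (phi K) \subset val (phi G)).
  apply: contra eG => sKG.
  have /val_inj/inj_phi -> // : val (phi G) = val (phi K).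
  by apply: (flat_eq_rank (M := M')); rewrite ?rpK //; apply: valP.
have e1 : e \in G1.
  apply: (IHk G1f) => //.
  have sb : b |: val (phi G) \subset val (phi G1f).
    rewrite subUset sub1set (subsetP (anti_phi (F1 := G1f) sG1K)) //=.
    exact: anti_phi.
  apply: subset_trans (sub_cl_of_rank (M := M') sb _) _.
    by rewrite rpG1 rank_setU1_flat //; apply: valP.
  apply: cl_sub_flat; first exact: valP.
  by rewrite subUset sub1set sub (subsetP (anti_phi sFeK)).
by rewrite e1 in eG1.
Qed.

End AntitoneRank.

(** * Hyperplanes as flats, and the rows of the transposed pattern *)

Lemma hyperplane_flat (E : finType) (M : matroid E) (H : {set E}) :
  hyperplane M H -> flat M H.
Proof. by case/andP. Qed.

Definition flat_of_hyperplane (E : finType) (M : matroid E)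
  (H : hyperplanes M) : flats M := exist _ (val H) (hyperplane_flat (valP H)).

Lemma flat_of_hyperplaneP (E : finType) (M : matroid E) (H : hyperplanes M) :
  hyperplane M (val (flat_of_hyperplane H)).
Proof. exact: (valP H). Qed.

(** For a singleton [A] this is the set [Z e]; for a flat [A] it is the value of the order-reversing
    map to be built. *)
Definition hyperplanes_above (E : finType) (M : matroid E) (A : {set E}) :
  {set hyperplanes M} := [set H : hyperplanes M | A \subset val H].

Lemma zero_set_fundamental (E : finType) (M : matroid E) (e : E) :
  zero_set (tr_pattern (fundamental_pattern M)) e = hyperplanes_above M [set e].
Proof.
apply/setP => H; rewrite !inE sub1set /tr_pattern /fundamental_pattern.
by case: (e \in val H).
Qed.

(** * Adjoints whose ground set is labelled by hyperplanes *)

Section LabelledAdjoint.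
Variables (E E' : finType) (M : matroid E) (M' : matroid E').
Variable f : hyperplanes M -> E'.
Hypotheses (bijf : bijective f) (eq_rank : mrank M' = mrank M).

Lemma adjoint_of_flats :
  (forall e, flat M' (f @: hyperplanes_above M [set e])) ->
  simple M' /\ exists2 phi : flats M -> flats M', adjoint_map phi &
    forall (F : flats M) (H : hyperplanes M),
      val F = val H -> val (phi F) = [set f H].
Proof.
move=> flatZ; have injf := bij_inj bijf; have [g fK gK] := bijf.
(* This set is the intersection of the flats [f @: hyperplanes_above M [set e]] over [e] in [F], so
   its closure stays inside each of them. *)
have flat_phi (F : flats M) : flat M' (f @: hyperplanes_above M (val F)).
  apply: flatP; apply/subsetP => x; rewrite -[x]gK => xcl.
  rewrite mem_imset // inE; apply/subsetP => e eF.
  suff : f (g x) \in f @: hyperplanes_above M [set e].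
    by rewrite mem_imset // inE sub1set.
  rewrite -(flatE (flatZ e)); apply: (subsetP (cl_mono _ _)) xcl.
  apply: imsetS; apply/subsetP => H; rewrite !inE.
  by apply: subset_trans; rewrite sub1set.
pose phi (F : flats M) : flats M' := Sub _ (flat_phi F).
have phiE F : val (phi F) = f @: hyperplanes_above M (val F) by [].
have anti (F1 F2 : flats M) : val F1 \subset val F2 ->
    val (phi F2) \subset val (phi F1).
  move=> s12; rewrite !phiE; apply: imsetS; apply/subsetP => H.
  by rewrite !inE; apply: subset_trans.
(* If [e] lies in [F1] but not in [F2], a hyperplane above [F2] that avoids [e] has its label in
   [phi F2] and not in [phi F1]. *)
have refl (F1 F2 : flats M) : val (phi F2) \subset val (phi F1) ->
    val F1 \subset val F2.
  move=> sub; apply/subsetP => e e1; apply: contraT => e2.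
  have [H [hH sH eH]] := hyperplane_separates (valP F2) e2.
  have /(subsetP sub) : f (Sub H hH) \in val (phi F2).
    by rewrite phiE mem_imset // inE SubK.
  rewrite phiE mem_imset // inE SubK => /subsetP/(_ e e1) eH'.
  by rewrite eH' in eH.
have inj : injective phi.
  move=> F1 F2 eq12; apply: val_inj; apply/eqP.
  by rewrite eqEsubset !refl ?eq12.
have phiH (F : flats M) (H : hyperplanes M) :
    val F = val H -> val (phi F) = [set f H].
  move=> FH; rewrite phiE FH.
  suff -> : hyperplanes_above M (val H) = [set H] by rewrite imset_set1.
  apply/setP => K.
  (* Nested hyperplanes coincide, because they are flats of equal rank. *)
  rewrite !inE; apply/idP/eqP => [sHK | -> //]; apply: val_inj.
  have /andP[_ /eqP rK] := valP K; have /andP[fH /eqP rH] := valP H.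
  by apply: (flat_eq_rank (M := M)) => //; rewrite -ltnS rK rH.
have point_phi (F : flats M) : hyperplane M (val F) -> point M' (val (phi F)).
  case/andP=> _ /eqP rF; rewrite /point (valP (phi F)) /=; apply/eqP.
  (* A hyperplane has rank one less than [M], so the rank formula leaves 1 for its image. *)
  apply: (@addnI (rank M (val F))).
  by rewrite (antitone_rankD eq_rank inj anti) addn1.
have point1 x : point M' [set x].
  have -> : [set x] = val (phi (flat_of_hyperplane (g x))).
    by rewrite (phiH _ (g x)) ?gK.
  exact: point_phi (flat_of_hyperplaneP _).
split; first exact/simpleP.
exists phi => //; split=> //; split=> // [F1 F2 _ _ /inj // | P pP].
have [P0|[x xP]] := set_0Vmem (val P).
  by move: pP; rewrite /point P0 rank0 andbF.
exists (flat_of_hyperplane (g x)); first exact: flat_of_hyperplaneP.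
apply: val_inj; rewrite (phiH _ (g x)) // gK.
by rewrite (point_set1 pP (point1 x) xP).
Qed.

Lemma flats_of_adjoint (phi : flats M -> flats M') : adjoint_map phi ->
  (forall (F : flats M) (H : hyperplanes M),
     val F = val H -> val (phi F) = [set f H]) ->
  forall e, flat M' (f @: hyperplanes_above M [set e]).
Proof.
move=> [inj anti _] phiH e; have [g fK gK] := bijf.
pose Fe : flats M := Sub (cl M [set e]) (flat_cl _ _).
suff -> : f @: hyperplanes_above M [set e] = val (phi Fe) by apply: valP.
apply/setP => x; rewrite -[x]gK mem_imset ?inE; last exact: bij_inj.
pose F := flat_of_hyperplane (g x).
(* With the label replaced by the image of its hyperplane, one direction is order reversal applied
   to [cl M [set e]] inside that hyperplane; the other is the descent argument. *)
rewrite -[f (g x) \in _]sub1set -(phiH F (g x)) //; apply/idP/idP => [eH | sub].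
  by apply: anti; apply: (cl_sub_flat (M := M)) => //; apply: (valP F).
rewrite sub1set.
exact: (antitone_reflects_mem eq_rank inj anti (G := F) _ sub).
Qed.

End LabelledAdjoint.

(** The points of a simple matroid are exactly its singletons, so the bijection from hyperplanes
    onto points amounts to a bijection onto the ground set. *)
Lemma adjoint_map_labelling (E E' : finType) (M : matroid E) (M' : matroid E')
    (phi : flats M -> flats M') : simple M' -> adjoint_map phi ->
  exists2 f : hyperplanes M -> E', bijective f &
    forall (F : flats M) (H : hyperplanes M),
      val F = val H -> val (phi F) = [set f H].
Proof.
move=> /simpleP sM' [inj _ [ptH _ surj]].
pose fl := @flat_of_hyperplane _ M.
have labelP H : exists x, val (phi (fl H)) == [set x].
  have pH := ptH _ (flat_of_hyperplaneP H).
  have [P0|[x xP]] := set_0Vmem (val (phi (fl H))).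
    by move: pH; rewrite /point P0 rank0 andbF.
  by exists x; apply/eqP; apply: (point_set1 pH (sM' x) xP).
pose f H := xchoose (labelP H).
have phif H : val (phi (fl H)) = [set f H] by apply/eqP; apply: (xchooseP (labelP H)).
have preim x : exists H, f H == x.
  have [F hF phiF] := surj (Sub [set x] (proj1 (andP (sM' x)))) (sM' x).
  exists (Sub (val F) hF); apply/eqP; apply: set1_inj; rewrite -phif.
  have -> : fl (Sub (val F) hF) = F by apply: val_inj.
  by rewrite phiF SubK.
exists f; last first.
  by move=> F H FH; rewrite -phif; congr (val (phi _)); apply: val_inj; rewrite SubK.
have fK x : f (xchoose (preim x)) = x by apply/eqP; apply: (xchooseP (preim x)).
exists (fun x => xchoose (preim x)) => // H.
have injf : injective f.
  move=> H1 H2 fH; apply: val_inj.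
  have /val_inj/inj/(congr1 val) : val (phi (fl H1)) = val (phi (fl H2)).
    by rewrite !phif fH.
  by rewrite !SubK.
exact: injf.
Qed.

Theorem theorem4p6 (E : finType) (M : matroid E) :
  (forall (E' : finType) (M' : matroid E'),
     adjoint M M' <->
     (exists2 N : matroid (hyperplanes M),
        matroid_iso N M' & in_R (tr_pattern (fundamental_pattern M)) N)
     /\ mrank M' = mrank M)
  /\
  (forall N : matroid (hyperplanes M),
     labelled_adjoint N <->
     in_R (tr_pattern (fundamental_pattern M)) N /\ mrank N = mrank M).
Proof.
(* The tautological labelling is the case where [f] is the identity, so both equivalences follow
   from the same two lemmas. *)
have bij_id : bijective (@id (hyperplanes M)) by exists id.
split=> [E' M' | N]; split.
- move=> [sM' rM' [phi adj]]; split=> //.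
  (* The adjoint map itself supplies the identification of ground sets: [N] is [M'] pulled back
     along the labelling it induces. *)
  have [f bijf phif] := adjoint_map_labelling sM' adj.
  have [N indepN] := pullback_matroid_exists M' (bij_inj bijf).
  exists N; first by exists f.
  move=> e; rewrite zero_set_fundamental -(flat_iso bijf indepN).
  exact: flats_of_adjoint phif e.
- move=> [[N [f bijf indepN] inR] rM'].
  have [|sM' [phi adj _]] := adjoint_of_flats bijf rM'.
    by move=> e; rewrite (flat_iso bijf indepN) -zero_set_fundamental.
  by split=> //; exists phi.
- move=> [sN rN [phi adj phiH]]; split=> // e.
  rewrite zero_set_fundamental -[hyperplanes_above _ _]imset_id.
  exact: (flats_of_adjoint bij_id rN adj phiH).
- move=> [inR rN].
  have [|sN [phi adj phiH]] := adjoint_of_flats bij_id rN.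
    by move=> e; rewrite imset_id -zero_set_fundamental.
  by split=> //; exists phi.
Qed.
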